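(* Let $K^*\in\mathbb{N}$, $M>0$, $p\in\mathbb{N}$, let $\mathcal{Y}\subset\mathbb{R}^{K^*}$ be a compact set, let $f_*:[-M,M]^p\to\mathcal{Y}$ be continuous, and let $g_*:\mathcal{Y}^2\to\mathbb{R}$ be a conditionally positive definite kernel. Let $\sigma:\mathbb{R}\to\mathbb{R}$ be either the ReLU function or a function that is non-constant, continuous, bounded and monotonically increasing. Then for every $\varepsilon>0$ there exist constants $C>0$ and $r_0>0$ such that for every $r\ge r_0$ there exist $K\in\mathbb{N}$, $T=T(K)\in\mathbb{N}$, $\boldsymbol A\in\mathbb{R}^{K\times T}$, $\boldsymbol B\in\mathbb{R}^{T\times p}$, $\boldsymbol c\in\mathbb{R}^T$ and $\gamma\in\mathbb{R}$ with $|\gamma|\le C r^2$ such that \[ \Big| g_*\big(f_*(\boldsymbol x),f_*(\boldsymbol x')\big) - \big( \langle f_{\boldsymbol\psi}(\boldsymbol x), f_{\boldsymbol\psi}(\boldsymbol x')\rangle - \gamma\big)\Big| < \varepsilon + C r^{-2} \] for all $(\boldsymbol x,\boldsymbol x')\in[-M,M]^{2p}$, where $f_{\boldsymbol\psi}(\boldsymbol x)=\boldsymbol A\,\boldsymbol\sigma(\boldsymbol B\boldsymbol x+\boldsymbol c)\in\mathbb{R}^K$ and $\boldsymbol\sigma$ denotes $\sigma$ applied element-wise.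
   Context: A kernel on $\mathcal{Y}^2$ is a symmetric continuous function $g:\mathcal{Y}^2\to\mathbb{R}$. A kernel $g$ is conditionally positive definite (CPD) if $\sum_{i=1}^n\sum_{j=1}^n c_ic_j g(\boldsymbol y_i,\boldsymbol y_j)\ge 0$ for all $n\in\mathbb{N}$, all $\boldsymbol y_1,\dots,\boldsymbol y_n\in\mathcal{Y}$ and all $c_1,\dots,c_n\in\mathbb{R}$ with $\sum_{i=1}^n c_i=0$. $\langle\cdot,\cdot\rangle$ is the Euclidean inner product. *)

(* Defs.v *)
From HB Require Import structures.
From mathcomp Require Import all_boot all_order all_algebra.
From mathcomp Require Import all_classical all_reals all_analysis.
Set Implicit Arguments. Unset Strict Implicit. Unset Printing Implicit Defensive.
Import Order.TTheory GRing.Theory Num.Theory.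
Import numFieldNormedType.Exports.
Local Open Scope classical_set_scope.
Local Open Scope ring_scope.

Definition cube (R : realType) (p : nat) (M : R) : set 'cV[R]_p :=
  [set x | forall i : 'I_p, `|x i ord0| <= M].

Definition inner (R : realType) (n : nat) (u v : 'cV[R]_n) : R :=
  \sum_(i < n) u i ord0 * v i ord0.

Definition is_kernel (R : realType) (n : nat) (Y : set 'cV[R]_n)
    (g : 'cV[R]_n -> 'cV[R]_n -> R) : Prop :=
  (forall y y', Y y -> Y y' -> g y y' = g y' y) /\
  {within Y `*` Y, continuous (fun z : 'cV[R]_n * 'cV[R]_n => g z.1 z.2)}.

Definition CPD (R : realType) (n : nat) (Y : set 'cV[R]_n)
    (g : 'cV[R]_n -> 'cV[R]_n -> R) : Prop :=
  is_kernel Y g /\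
  forall (m : nat) (ys : 'I_m -> 'cV[R]_n) (c : 'I_m -> R),
    (forall i, Y (ys i)) -> \sum_(i < m) c i = 0 ->
    0 <= \sum_(i < m) \sum_(j < m) c i * c j * g (ys i) (ys j).

Definition relu (R : realType) (x : R) : R := Num.max x 0.

Definition admissible_activation (R : realType) (sigma : R -> R) : Prop :=
  sigma = @relu R \/
  ((exists a b, sigma a <> sigma b) /\
   continuous sigma /\
   (exists B : R, forall x, `|sigma x| <= B) /\
   (forall x y, x <= y -> sigma x <= sigma y)).

Definition network (R : realType) (sigma : R -> R) (K T p : nat)
    (A : 'M[R]_(K, T)) (B : 'M[R]_(T, p)) (c : 'cV[R]_T) (x : 'cV[R]_p)
    : 'cV[R]_K :=
  A *m map_mx sigma (B *m x + c).

(* Main.v *)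
(* Write k x x' = gstar (fstar x) (fstar x'), a continuous CPD kernel on the cube.

   Bernstein polynomials in the coordinates u_i, affine images of exp x_i, form a
   partition of unity W_a that concentrates near nodes pt a, so that
   k x x' is uniformly close to the sum of W_a x * W_b x' * G a b with
   G a b = k (pt a) (pt b). The matrix G is CPD; with h a = G a s - G s s / 2 for a
   base index s, the matrix G a b + r^2 + h a * h b / r^2 is positive semidefinite,
   hence a Gram matrix of vectors L_a. This gives gamma = r^2, an error O(r^-2), and
   the feature map x |-> sum of W_a x * L_a.

   Choosing Bernstein polynomials in exp x_i makes each W_a a linear combination of
   the ridge functions exp (b . x), and exp is approximated on an interval by
   staircases built from steep copies of sigma (for ReLU, of the clipped ramp
   relu t - relu (t - 1)). This replaces Mercer's theorem and the general universal
   approximation theorem. *)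

Require Import Defs.
From HB Require Import structures.
From mathcomp Require Import all_boot all_order all_algebra.
From mathcomp Require Import all_classical all_reals all_analysis.
From mathcomp Require Import ring lra.
Import Order.TTheory GRing.Theory Num.Theory.
Import numFieldNormedType.Exports.
Local Open Scope classical_set_scope.
Local Open Scope ring_scope.

(** * Gram factorisation of positive semidefinite kernels on finite sets *)

Definition quad_form {R : realType} {I : finType} (k : I -> I -> R) (c : I -> R) : R :=
  \sum_i \sum_j c i * c j * k i j.

Definition psd {R : realType} {I : finType} (k : I -> I -> R) : Prop :=
  (forall i j, k i j = k j i) /\ forall c, 0 <= quad_form k c.

(** A quadratic polynomial in [t], used with several shifts: free [t] to test a zero pivot, the
    minimising [t] for Schur complements, and [t] equal to the total weight to make the coefficients
    sum to zero. *)
Lemma quad_form_shift {R : realType} {I : finType} (k : I -> I -> R) (c : I -> R)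
    (s : I) (t : R) : (forall i j, k i j = k j i) ->
  quad_form k (fun i => c i - t * (i == s)%:R) =
  quad_form k c - 2 * t * (\sum_i c i * k i s) + t ^+ 2 * k s s.
Proof.
move=> ksym.
have dirac (F : I -> R) : \sum_i (i == s)%:R * F i = F s.
  rewrite (bigD1 s) //= eqxx mul1r big1 ?addr0 // => i /negbTE ->.
  by rewrite mul0r.
have E i : \sum_j (c i - t * (i == s)%:R) * (c j - t * (j == s)%:R) * k i j =
    \sum_j c i * c j * k i j - t * ((i == s)%:R * (\sum_j c j * k i j))
      - t * (c i * k i s) + t ^+ 2 * ((i == s)%:R * k i s).
  rewrite -(dirac (k i)) !mulr_sumr -!sumrB -big_split /=.
  by apply: eq_bigr => j _; ring.
rewrite /quad_form (eq_bigr _ (fun i _ => E i)) big_split /= !sumrB.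
rewrite -!mulr_sumr !dirac.
have -> : \sum_j c j * k s j = \sum_j c j * k j s.
  by apply: eq_bigr => j _; rewrite ksym.
by ring.
Qed.

Lemma psd_diag_ge0 {R : realType} {I : finType} (k : I -> I -> R) (s : I) :
  psd k -> 0 <= k s s.
Proof.
case=> ksym /(_ (fun i => 0 - (-1) * (i == s)%:R)).
rewrite (quad_form_shift _ (fun=> 0)) //.
rewrite /quad_form big1 => [|i _]; last by rewrite big1 // => j _; rewrite !mul0r.
rewrite big1 => [|i _]; last by rewrite mul0r.
by rewrite mulr0 subr0 add0r sqrrN expr1n mul1r.
Qed.

(* Test the form on [e_i - t e_s], with [t] chosen to make it negative. *)
Lemma psd_diag_eq0 {R : realType} {I : finType} (k : I -> I -> R) (s i : I) :
  psd k -> k s s = 0 -> k i s = 0.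
Proof.
move=> kpsd ks0; have [ksym kge0] := kpsd.
have dirac (F : I -> R) a : \sum_j (j == a)%:R * F j = F a.
  rewrite (bigD1 a) //= eqxx mul1r big1 ?addr0 // => j /negbTE ->.
  by rewrite mul0r.
have Q t : 0 <= k i i - 2 * t * k i s.
  have := kge0 (fun j => (j == i)%:R - t * (j == s)%:R).
  rewrite quad_form_shift // ks0 mulr0 addr0 dirac /quad_form.
  suff -> : \sum_a \sum_j (a == i)%:R * (j == i)%:R * k a j = k i i by [].
  rewrite -[RHS](dirac (k i)) -[RHS](dirac (fun a => \sum_j (j == i)%:R * k a j)).
  apply: eq_bigr => a _; rewrite mulr_sumr; apply: eq_bigr => j _.
  by rewrite mulrA.
apply/eqP/negPn/negP => kn0.
have := Q ((k i i + 1) / (2 * k i s)).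
have -> : 2 * ((k i i + 1) / (2 * k i s)) * k i s = k i i + 1 by field.
lra.
Qed.

(* One step of Cholesky elimination; when the pivot is 0, the convention
   [0^-1 = 0] makes it the identity, which is right by [psd_diag_eq0]. *)
Definition schur {R : realType} {I : finType} (k : I -> I -> R) (s i j : I) : R :=
  k i j - k i s * k j s / k s s.

(** For a nonzero pivot, the Schur form at [c] is the minimum over [t] of the form of [k] at
    [c - t e_s], attained at [t = u / k s s]. *)
Lemma psd_schur {R : realType} {I : finType} (k : I -> I -> R) (s : I) :
  psd k -> psd (schur k s).
Proof.
move=> kpsd; have [ksym kge0] := kpsd; split.
  by move=> i j; rewrite /schur ksym (mulrC (k i s)).
move=> c; set u := \sum_i c i * k i s.
have -> : quad_form (schur k s) c = quad_form k c - u ^+ 2 / k s s.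
  rewrite /quad_form expr2 {1}/u !mulr_suml -sumrB.
  apply: eq_bigr => i _; rewrite mulr_sumr mulr_suml -sumrB.
  by apply: eq_bigr => j _; rewrite /schur; ring.
have [ks0|ks0] := eqVneq (k s s) 0; first by rewrite ks0 invr0 mulr0 subr0.
have := kge0 (fun i => c i - u / k s s * (i == s)%:R).
rewrite quad_form_shift // -/u.
by congr (_ <= _); field.
Qed.

Lemma schur_pivot {R : realType} {I : finType} (k : I -> I -> R) (s i : I) :
  psd k -> schur k s i s = 0.
Proof.
move=> kpsd; rewrite /schur; have [ks0|ks0] := eqVneq (k s s) 0.
  by rewrite (psd_diag_eq0 _ _ i kpsd ks0) ks0 !mul0r subrr.
by field.
Qed.

Lemma schur_eq0 {R : realType} {I : finType} (k : I -> I -> R) (s t : I) :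
  psd k -> (forall i, k i t = 0) -> forall i, schur k s i t = 0.
Proof.
by move=> [ksym _] kt i; rewrite /schur (ksym t s) !kt mulr0 mul0r subrr.
Qed.

(** Cholesky factorisation, by induction on a list [r] outside which all columns vanish. Eliminating
    [s] clears its column and keeps the zero columns zero; the rank-one part removed is one more
    Gram coordinate. *)
Lemma psd_gram {R : realType} {I : finType} (k : I -> I -> R) : psd k ->
  exists (K : nat) (L : 'I_K -> I -> R), forall i j, k i j = \sum_l L l i * L l j.
Proof.
suff H (r : seq I) : forall k : I -> I -> R, psd k ->
    (forall t, t \notin r -> forall i, k i t = 0) ->
    exists (K : nat) (L : 'I_K -> I -> R), forall i j, k i j = \sum_l L l i * L l j.
  by move=> kpsd; apply: (H (enum I)) => // t; rewrite mem_enum.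
elim: r => [|s r IH] {}k kpsd k0.
  exists 0%N, (fun _ _ => 0) => i j; rewrite big_ord0.
  exact: k0.
have [||K [L kL]] := IH (schur k s); first exact: psd_schur.
  move=> t tr; have [->|ts] := eqVneq t s => [i|]; first exact: schur_pivot.
  by apply: schur_eq0 => // i; apply: k0; rewrite inE (negbTE ts).
(* Index [ord0] carries the new coordinate. For a zero pivot it is 0, consistently with the
   convention in [schur]. *)
exists K.+1, (fun l i => if unlift ord0 l is Some l' then L l' i
                         else k i s / Num.sqrt (k s s)) => i j.
rewrite big_ord_recl unlift_none.
under eq_bigr do rewrite liftK.
have -> : k i s / Num.sqrt (k s s) * (k j s / Num.sqrt (k s s)) = k i s * k j s / k s s.
  rewrite mulrACA -invfM -expr2 sqr_sqrtr //; exact: psd_diag_ge0.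
by rewrite -kL /schur addrCA subrr addr0.
Qed.

Lemma quad_form_rank1 {R : realType} {I : finType} (u : I -> R) (c : I -> R) :
  quad_form (fun i j => u i * u j) c = (\sum_i c i * u i) ^+ 2.
Proof.
rewrite /quad_form expr2 mulr_suml; apply: eq_bigr => i _.
by rewrite mulr_sumr; apply: eq_bigr => j _; ring.
Qed.

Lemma quad_formD {R : realType} {I : finType} (k l : I -> I -> R) (c : I -> R) :
  quad_form (fun i j => k i j + l i j) c = quad_form k c + quad_form l c.
Proof.
rewrite /quad_form -big_split /=; apply: eq_bigr => i _.
by rewrite -big_split /=; apply: eq_bigr => j _; rewrite mulrDr.
Qed.

Lemma quad_form_sum {R : realType} {I : finType} (b : I -> R) (c : I -> R) :
  quad_form (fun i j => b i + b j) c = 2 * (\sum_i c i) * (\sum_i c i * b i).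
Proof.
rewrite (_ : 2 * _ * _ = (\sum_i c i * b i) * (\sum_j c j)
   + (\sum_i c i) * (\sum_j c j * b j)); last by ring.
rewrite /quad_form !mulr_suml -big_split /=; apply: eq_bigr => i _.
by rewrite !mulr_sumr -big_split /=; apply: eq_bigr => j _; ring.
Qed.

(* With a base point [s], a conditionally positive definite [G] splits as
   [G0 + h i + h j], where [G0] is positive semidefinite; adding
   [r^2 + h i * h j / r^2] completes a rank-one square. *)
Lemma cpd_shift_psd {R : realType} {I : finType} (G : I -> I -> R) (s : I) (r : R) :
  r != 0 -> (forall i j, G i j = G j i) ->
  (forall c, \sum_i c i = 0 -> 0 <= quad_form G c) ->
  psd (fun i j => G i j + r ^+ 2 +
        (G i s - G s s / 2) * (G j s - G s s / 2) / r ^+ 2).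
Proof.
move=> r0 Gsym Gcpd; split.
  by move=> i j; rewrite Gsym (mulrC (G i s - _)).
move=> c; set C := \sum_i c i.
have dirac : \sum_i (i == s)%:R = 1 :> R.
  rewrite (bigD1 s) //= eqxx big1 ?addr0 // => i /negbTE -> //.
(* Moving the total weight [C] onto the base point gives coefficients of sum zero, to which
   conditional positivity applies. *)
have := Gcpd (fun i => c i - C * (i == s)%:R).
rewrite sumrB -mulr_sumr dirac mulr1 subrr => /(_ erefl).
rewrite quad_form_shift // => Q0.
pose b i := G i s - G s s / 2.
pose u i := r + b i / r.
have Sb : \sum_i c i * b i = (\sum_i c i * G i s) - C * (G s s / 2).
  by rewrite mulr_suml -sumrB; apply: eq_bigr => i _; rewrite mulrBr.
have := quad_form_sum b c; rewrite Sb -/C => Qb.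
(* Since [(r + b i / r) * (r + b j / r) = r^2 + b i + b j + b i * b j / r^2], adding [b i + b j] to
   the kernel leaves [G] plus a rank-one square. By [Qb], subtracting it back turns the form of [G]
   into the one in [Q0]. *)
set T := quad_form _ c; suff : T + quad_form (fun i j => b i + b j) c =
    quad_form G c + quad_form (fun i j => u i * u j) c.
  rewrite Qb quad_form_rank1; have := sqr_ge0 (\sum_i c i * u i); lra.
rewrite -!quad_formD; apply: eq_bigr => i _; apply: eq_bigr => j _.
by rewrite /u /b; field.
Qed.

(** * Networks and ridge exponentials *)

Lemma archi_div_lt {R : realType} (a e : R) : 0 < e -> exists n : nat, a / n.+1%:R < e.
Proof.
move=> e0; exists (Num.bound `|a / e|).
rewrite ltr_pdivrMr ?ltr0Sn // mulrC -ltr_pdivrMr //.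
apply: le_lt_trans (ler_norm _) _; apply: lt_trans (archi_boundP (normr_ge0 _)) _.
by rewrite ltr_nat.
Qed.

(* A neuron is a triple (outer weight, inner weights, bias). *)
Definition net {R : realType} {p : nat} (sigma : R -> R)
    (s : seq (R * 'cV[R]_p * R)) (x : 'cV[R]_p) : R :=
  \sum_(q <- s) q.1.1 * sigma (inner q.1.2 x + q.2).

Definition net_approx {R : realType} {p : nat} (sigma : R -> R) (M : R)
    (f : 'cV[R]_p -> R) : Prop :=
  forall e, 0 < e -> exists s, forall x, @cube R p M x -> `|f x - net sigma s x| < e.

Section NetApprox.
Context {R : realType} {p : nat} (sigma : R -> R) (M : R).
Implicit Types f g : 'cV[R]_p -> R.

Lemma net_approx_closed f :
  (forall e, 0 < e -> exists2 g, net_approx sigma M g &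
     forall x, @cube R p M x -> `|f x - g x| < e) ->
  net_approx sigma M f.
Proof.
move=> H e e0; have e20 : 0 < e / 2 by rewrite divr_gt0.
have [g /(_ _ e20) [s gs] fg] := H _ e20; exists s => x xM.
apply: le_lt_trans (ler_distD (g x) _ _) _.
by have := gs x xM; have := fg x xM; lra.
Qed.

Lemma eq_net_approx f g : (forall x, f x = g x) ->
  net_approx sigma M f -> net_approx sigma M g.
Proof. by move=> fg fa e /fa [s sP]; exists s => x xM; rewrite -fg sP. Qed.

Lemma net_approxD f g : net_approx sigma M f -> net_approx sigma M g ->
  net_approx sigma M (fun x => f x + g x).
Proof.
move=> fa ga e e0; have e20 : 0 < e / 2 by rewrite divr_gt0.
have [s sP] := fa _ e20; have [t tP] := ga _ e20; exists (s ++ t) => x xM.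
rewrite /net big_cat /= -!/(net _ _ _) opprD addrACA.
apply: le_lt_trans (ler_normD _ _) _.
by have := sP x xM; have := tP x xM; lra.
Qed.

Lemma net_approxZ (a : R) f : net_approx sigma M f ->
  net_approx sigma M (fun x => a * f x).
Proof.
move=> fa e e0; have d0 : 0 < e / (`|a| + 1) by rewrite divr_gt0 // ltr_wpDl.
have [s sP] := fa _ d0; exists [seq (a * q.1.1, q.1.2, q.2) | q <- s] => x xM.
have -> : net sigma [seq (a * q.1.1, q.1.2, q.2) | q <- s] x = a * net sigma s x.
  by rewrite /net big_map mulr_sumr; apply: eq_bigr => q _ /=; rewrite mulrA.
rewrite -mulrBr normrM; have := sP x xM.
rewrite ltr_pdivlMr ?ltr_wpDl // => H; apply: le_lt_trans H.
by rewrite mulrC ler_wpM2l // lerDl.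
Qed.

Lemma net_approx_neuron (b : 'cV[R]_p) (c : R) : net_approx sigma M (fun x => sigma (inner b x + c)).
Proof.
move=> e e0; exists [:: (1, b, c)] => x xM.
by rewrite /net big_seq1 mul1r subrr normr0.
Qed.

Lemma inner0l n (x : 'cV[R]_n) : inner (0 : 'cV[R]_n) x = 0.
Proof. by rewrite /inner big1 // => i _; rewrite mxE mul0r. Qed.

(** There is no output bias, so constants come from a neuron with zero inner weights and a bias
    where [sigma] does not vanish. *)
Lemma net_approx_cst (a : R) : (exists c, sigma c <> 0) -> @net_approx R p sigma M (fun=> a).
Proof.
case=> c /eqP sc; apply: eq_net_approx (net_approxZ (a / sigma c) _ (net_approx_neuron 0 c)).
by move=> x; rewrite inner0l add0r divfK.
Qed.

Lemma net_approx_sum (I : Type) (r : seq I) (F : I -> 'cV[R]_p -> R) :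
  (forall i, net_approx sigma M (F i)) ->
  net_approx sigma M (fun x => \sum_(i <- r) F i x).
Proof.
move=> FA; elim: r => [|i r IH].
  apply: eq_net_approx (_ : @net_approx R p sigma M (fun=> 0)) => [x|e e0].
    by rewrite big_nil.
  by exists [::] => x _; rewrite /net big_nil subrr normr0.
by apply: eq_net_approx (net_approxD _ _ (FA i) IH) => x; rewrite big_cons.
Qed.

End NetApprox.

(** * Staircase approximation of monotone functions *)

Section Staircase.
Context {R : realType} (g : R -> R) (a h : R).
Hypotheses (gmono : forall x y : R, x <= y -> g x <= g y) (h0 : 0 < h).

Let s (k : nat) : R := a + k%:R * h.

(** [H] plays the role of a Heaviside step; each increment of [g] is switched on at the right end of
    its cell. *)
Definition staircase (H : R -> R) (n : nat) (t : R) : R :=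
  \sum_(k < n) (g (a + k.+1%:R * h) - g (a + k%:R * h)) * H (t - (a + k.+1%:R * h)).

Let sS k : s k.+1 = s k + h.
Proof. by rewrite /s -natr1 mulrDl mul1r addrA. Qed.

Let step (t : R) : R := (0 <= t)%R%:R.

Let staircaseS H n t :
  staircase H n.+1 t = staircase H n t + (g (s n.+1) - g (s n)) * H (t - s n.+1).
Proof. by rewrite /staircase big_ord_recr. Qed.

Let stair_full (n : nat) (t : R) : s n <= t -> staircase step n t = g (s n) - g a.
Proof.
elim: n => [|n IH] st.
  by rewrite /staircase big_ord0 /s mul0r addr0 subrr.
rewrite staircaseS IH; last by apply: le_trans st; rewrite sS lerDl ltW.
by rewrite /step subr_ge0 st mulr1 addrC addrA subrK.
Qed.

Let stair_le (n : nat) (t : R) : a <= t -> staircase step n t <= g t - g a.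
Proof.
move=> at_; elim: n => [|n IH].
  by rewrite /staircase big_ord0 subr_ge0 gmono.
have [st|st] := leP (s n.+1) t; first by rewrite stair_full // lerD2r gmono.
by rewrite staircaseS /step subr_ge0 (lt_geF st) mulr0 addr0.
Qed.

(** Increments wait for the right end of their cell, so the exact staircase lags by at most one
    mesh; it stops growing after the last node, hence the minimum. *)
Let stair_ge (n : nat) (t : R) : g (Num.min (t - h) (s n)) - g a <= staircase step n t.
Proof.
elim: n => [|n IH].
  rewrite /staircase big_ord0 subr_le0 gmono // ge_min.
  by rewrite /s mul0r addr0 lexx orbT.
have [st|st] := leP (s n.+1) t.
  by rewrite stair_full // lerD2r gmono // ge_min lexx orbT.
rewrite staircaseS /step subr_ge0 (lt_geF st) mulr0 addr0; apply: le_trans IH.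
rewrite lerD2r gmono // le_min ge_min lexx /= ge_min.
by move: st; rewrite sS -ltrBlDr => /ltW ->.
Qed.

(** Up to [d], [H] lies between the exact steps translated by [h] either way. Weighted by the
    nonnegative increments, these errors add up to [d] times the total variation; [2 * h] combines
    this translation with the lag of the exact staircase. *)
Lemma staircase_approx (H : R -> R) (d : R) (n : nat) (t : R) :
  (forall t : R, 0 <= H t <= 1) -> (forall t : R, h <= t -> 1 - d <= H t) ->
  (forall t : R, t <= - h -> H t <= d) -> 0 <= d ->
  a <= t <= a + n%:R * h ->
  g (t - 2 * h) - d * (g (s n) - g a) <= g a + staircase H n t
     <= g (t + h) + d * (g (s n) - g a).
Proof.
move=> H01 Hr Hl d0 /andP[at_ ts].
have D0 k : 0 <= g (s k.+1) - g (s k) by rewrite subr_ge0 gmono // sS lerDl ltW.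
have V : g (s n) - g a = \sum_(k < n) (g (s k.+1) - g (s k)).
  elim: n {ts} => [|n IH]; first by rewrite big_ord0 /s mul0r addr0 subrr.
  by rewrite big_ord_recr /= -IH; ring.
apply/andP; split.
  have := stair_ge n (t - h).
  rewrite (_ : t - h - h = t - 2 * h); last by ring.
  rewrite min_l; last by rewrite (le_trans _ ts) // gerDl oppr_le0 mulr_ge0 // ltW.
  suff : staircase step n (t - h) - d * (g (s n) - g a) <= staircase H n t by lra.
  rewrite V mulr_sumr -sumrB; apply: ler_sum => k _.
  rewrite -!/(s _) [d * _]mulrC -mulrBr ler_wpM2l //.
  have := H01 (t - s k.+1) => /andP[H0 H1].
  by rewrite /step; case: (leP 0 (t - h - s k.+1)) => /= ht; [have /Hr : h <= t - s k.+1 by lra | ]; lra.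
have := stair_le n (t + h) (le_trans at_ (ltW (ltr_pwDr h0 (lexx t)))).
suff : staircase H n t <= staircase step n (t + h) + d * (g (s n) - g a) by lra.
rewrite V mulr_sumr -big_split /=; apply: ler_sum => k _.
rewrite -!/(s _) [d * _]mulrC -mulrDr ler_wpM2l //.
have := H01 (t - s k.+1) => /andP[H0 H1].
by rewrite /step; case: (leP 0 (t + h - s k.+1)) => /= ht; [ | have /Hl : t - s k.+1 <= - h by lra]; lra.
Qed.

End Staircase.

(** [l] and [L] are the infimum and supremum of the range, which monotonicity turns into limits at
    the two infinities. *)
Lemma sigmoid_limits {R : realType} (sigma : R -> R) :
  (exists a b, sigma a <> sigma b) -> (exists B, forall x, `|sigma x| <= B) ->
  (forall x y, x <= y -> sigma x <= sigma y) ->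
  exists l L, [/\ l < L, forall x, l <= sigma x <= L &
    forall d, 0 < d -> exists2 X : R, 0 < X & forall x, X <= x ->
      L - d <= sigma x /\ sigma (- x) <= l + d].
Proof.
move=> [a [b ab]] [B sB] smono.
have hs : has_sup (range sigma).
  split; first by exists (sigma 0), 0.
  by exists B => _ [x _ <-]; apply: le_trans (sB x); exact: ler_norm.
have hi : has_inf (range sigma).
  split; first by exists (sigma 0), 0.
  by exists (- B) => _ [x _ <-]; have := sB x; rewrite ler_norml => /andP[].
have sle x : inf (range sigma) <= sigma x <= sup (range sigma).
  apply/andP; split; first by apply: ge_inf; [exact: hi.2 | exists x].
  by apply: ub_le_sup; [exact: hs.2 | exists x].
exists (inf (range sigma)), (sup (range sigma)); split=> //.
  have := sle a; have := sle b; move/eqP: ab; rewrite neq_lt.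
  by move=> /orP[] ?; lra.
move=> d d0.
have [_ [x _ <-] xL] := sup_adherent d0 hs.
have [_ [y _ <-] yl] := inf_adherent d0 hi.
exists (`|x| + `|y| + 1); first by rewrite ltr_wpDl // addr_ge0.
move=> z zX; have := ler_norm x; have := ler_norm (- y); rewrite normrN => ny nx.
have x0 := normr_ge0 x; have y0 := normr_ge0 y.
split.
  by apply: le_trans (ltW xL) _; apply: smono; lra.
by apply: le_trans (_ : sigma y <= _); [apply: smono; lra | exact: ltW].
Qed.

Lemma innerZl {R : realType} (n : nat) (w : R) (u v : 'cV[R]_n) :
  inner (w *: u) v = w * inner u v.
Proof. by rewrite /inner mulr_sumr; apply: eq_bigr => i _; rewrite mxE mulrA. Qed.

Lemma innerDl {R : realType} (n : nat) (u u' v : 'cV[R]_n) :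
  inner (u + u') v = inner u v + inner u' v.
Proof. by rewrite /inner -big_split; apply: eq_bigr => i _; rewrite mxE mulrDl. Qed.

Lemma inner_cube_bound {R : realType} (p : nat) (M : R) (b : 'cV[R]_p) :
  exists2 S : R, 0 < S & forall x, @cube R p M x -> `|inner b x| <= S.
Proof.
have [S _ H] : exists2 S, True & forall x, @cube R p M x -> `|inner b x| <= S.
  exists (\sum_i `|b i ord0| * M) => // x xM.
  apply: le_trans (ler_norm_sum _ _ _) _; apply: ler_sum => i _.
  by rewrite normrM ler_wpM2l.
exists (Num.max 1 S) => [|x /H xS]; first by rewrite lt_max ltr01.
by rewrite le_max xS orbT.
Qed.

Lemma expR_sub_le {R : realType} (s t : R) : expR s - expR t <= expR s * (s - t).
Proof.
have := expR_ge1Dx (t - s); have := expR_gt0 s => s0 H.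
have -> : expR t = expR s * expR (t - s) by rewrite -expRD; congr expR; ring.
nra.
Qed.

Lemma net_approx_expR_sigmoid {R : realType} {p : nat} (sigma : R -> R) (M : R)
    (b : 'cV[R]_p) :
  (exists a b, sigma a <> sigma b) -> (exists B, forall x, `|sigma x| <= B) ->
  (forall x y, x <= y -> sigma x <= sigma y) ->
  net_approx sigma M (fun x => expR (inner b x)).
Proof.
move=> nc bd smono; have [l [L [lL slL slim]]] := sigmoid_limits sigma nc bd smono.
have cst a : @net_approx R p sigma M (fun=> a).
  apply: net_approx_cst; apply: contrapT => s0; case: nc => u [v] uv; apply: uv.
  by transitivity (0 : R); [|symmetry]; apply: contrapT => su; apply: s0; eexists; exact: su.
have [S S0 bS] := inner_cube_bound p M b.
apply: net_approx_closed => e e0.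
(* [E] bounds the exponential at [inner b x + h] once [h <= 1]. The two entries of the minimum below
   give a mesh error [2 * h * E < e / 2] and this bound on [h]. *)
pose E := expR (S + 1); have E0 : 0 < E := expR_gt0 _.
have m0 : 0 < Num.min (e / 2) E by rewrite lt_min divr_gt0.
have [n nm] := archi_div_lt (2 * S * (2 * E)) _ m0.
pose h := 2 * S / n.+1%:R.
have h0 : 0 < h by rewrite divr_gt0 // mulr_gt0.
have hE : h * (2 * E) < Num.min (e / 2) E by apply: le_lt_trans nm; rewrite /h mulrAC.
have {hE} [he hE] : h * (2 * E) < e / 2 /\ h * (2 * E) < E.
  by move: hE; rewrite lt_min => /andP[].
have h1 : h <= 1 by nra.
(* The total variation is at most [E], so imperfect steps cost at most [d * E = e / 2]. *)
pose d := e / (2 * E).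
have d0 : 0 < d by rewrite divr_gt0 // mulr_gt0.
have LlV : L - l != 0 by rewrite subr_eq0 gt_eqF.
have Ll0 : 0 < L - l by rewrite subr_gt0.
have [X X0 Xlim] := slim ((L - l) * d) (mulr_gt0 Ll0 d0).
(* Steepness [w] squeezes the transition of [sigma] from [[-X, X]] into [[-h, h]]. *)
pose w := X / h; have w0 : 0 < w by rewrite divr_gt0.
pose H t := (sigma (w * t) - l) / (L - l).
have wh : w * h = X by rewrite divfK // gt_eqF.
have H01 t : 0 <= H t <= 1.
  have /andP[? ?] := slL (w * t).
  by rewrite divr_ge0 ?ler_pdivrMr ?mul1r ?lerD2r ?subr_ge0 ?(ltW lL).
have Hr t : h <= t -> 1 - d <= H t.
  move=> ht; rewrite ler_pdivlMr //.
  have [] := Xlim (w * t); first by rewrite -wh ler_pM2l.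
  by move=> ? _; nra.
have Hl t : t <= - h -> H t <= d.
  move=> ht; rewrite ler_pdivrMr //.
  have [] := Xlim (w * (- t)); first by rewrite -wh ler_pM2l // lerNr.
  by rewrite mulrN opprK => _ ?; nra.
have eh x : @cube R p M x -> - S <= inner b x <= - S + n.+1%:R * h.
  move=> /bS; rewrite ler_norml => /andP[? ?].
  by rewrite /h mulrCA divff ?pnatr_eq0 // mulr1; apply/andP; split; lra.
exists (fun x => expR (- S) + staircase expR (- S) h H n.+1 (inner b x)).
  apply: net_approxD; first exact: cst.
  apply: net_approx_sum => k; apply: net_approxZ.
  set t := - S + _.
  apply: eq_net_approx (net_approxZ _ _ (L - l)^-1 _ (net_approxD _ _ _ _
    (net_approx_neuron _ _ (w *: b) (- (w * t))) (cst (- l)))) => x.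
  by rewrite innerZl /H mulrC mulrBr.
move=> x xM; have /andP[xl xr] := eh x xM.
have emono (u v : R) : u <= v -> expR u <= expR v by rewrite ler_expR.
have := staircase_approx expR (- S) h emono h0 H d n.+1 (inner b x)
  H01 Hr Hl (ltW d0) (eh x xM).
set V := expR (- S + _) - _; set T := _ + staircase _ _ _ _ _ _.
have VE : d * V <= e / 2.
  have : V <= E.
    have := expR_gt0 (- S).
    suff : expR (- S + n.+1%:R * h) <= E by rewrite /V; lra.
    by rewrite ler_expR /h mulrCA divff ?pnatr_eq0 // mulr1; lra.
  move=> /(ler_wpM2l (ltW d0)) dV; apply: (le_trans dV).
  by rewrite le_eqVlt; apply/orP; left; apply/eqP; rewrite /d; field; rewrite gt_eqF.
have := expR_sub_le (inner b x) (inner b x - 2 * h).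
have := expR_sub_le (inner b x + h) (inner b x).
have : expR (inner b x + h) <= E by rewrite ler_expR; move: (bS x xM); rewrite ler_norml; lra.
have : expR (inner b x) <= E by rewrite ler_expR; move: (bS x xM); rewrite ler_norml; lra.
rewrite (_ : inner b x + h - inner b x = h); last by ring.
rewrite (_ : inner b x - (inner b x - 2 * h) = 2 * h); last by ring.
move=> E1 E2 D2 D1 /andP[T1 T2].
rewrite ltr_norml; apply/andP; split; nra.
Qed.

(** Brings ReLU under the sigmoidal case: a clipped ramp is bounded and monotone, and each such
    neuron is two ReLU neurons with opposite outer weights and biases differing by 1. *)
Lemma net_approx_relu {R : realType} {p : nat} (M : R) (f : 'cV[R]_p -> R) :
  net_approx (fun t => relu t - relu (t - 1)) M f -> net_approx (@relu R) M f.
Proof.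
move=> fa e /fa [s sP].
exists (flatten [seq [:: q; (- q.1.1, q.1.2, q.2 - 1)] | q <- s]) => x /sP.
suff -> : net (@relu R) (flatten [seq [:: q; (- q.1.1, q.1.2, q.2 - 1)] | q <- s]) x =
  net (fun t => relu t - relu (t - 1)) s x by [].
rewrite /net big_flatten /= big_map; apply: eq_bigr => q _.
by rewrite !big_cons big_nil /= addr0 mulNr addrA mulrBr.
Qed.

Lemma net_approx_expR {R : realType} {p : nat} (sigma : R -> R) (M : R) (b : 'cV[R]_p) :
  admissible_activation sigma -> net_approx sigma M (fun x => expR (inner b x)).
Proof.
case=> [->|[nc [_ [bd smono]]]]; last exact: net_approx_expR_sigmoid.
have reluE (t : R) : relu t = if 0 <= t then t else 0.
  by rewrite /relu; case: (leP 0 t).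
apply: net_approx_relu; apply: net_approx_expR_sigmoid.
- by exists 0, 1; rewrite !reluE !subr_ge0 !lexx ler01 ler10; lra.
- exists 1 => x; rewrite !reluE.
  by case: (leP 0 x); case: (leP 0 (x - 1)) => *; rewrite ler_norml; lra.
- move=> x y xy; rewrite !reluE.
  by case: (leP 0 x); case: (leP 0 (x - 1)); case: (leP 0 y);
    case: (leP 0 (y - 1)) => *; lra.
Qed.

(** * Continuity on the cube *)

Lemma compact_uniform_continuity {R : realType} {T : pseudoMetricType R} (A : set T)
    (f : T -> R) : compact A -> {within A, continuous f} ->
  forall e, 0 < e -> exists2 d : R, 0 < d &
    forall x y, A x -> A y -> ball x d y -> `|f x - f y| < e.
Proof.
move=> /compact_near_coveringP cA /subspace_continuousP fc e e0.
have e20 : 0 < e / 2 by rewrite divr_gt0.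
(* Near-covering compactness along the filter of small positive radii: radii that work near each
   point yield one that works on all of [A]. *)
have := cA R (0^'+) (fun d x => A x -> forall y, A y -> ball x d y -> `|f x - f y| < e) _.
case=> [x Ax|d /= d0 H].
  have /= /cvgrPdist_lt /(_ _ e20) := fc x Ax.
  rewrite near_withinE => /nbhs_ballP [d /= d0 dB].
  have d20 : 0 < d / 2 by rewrite divr_gt0.
  exists (ball x (d / 2), [set t | t < d / 2]).
    split; first exact: nbhsx_ballx.
    exact: nbhs_right_lt.
  move=> [x' t] /= [xx' td] Ax' y Ay x'y.
  have fx' : `|f x - f x'| < e / 2.
    by apply: dB => //; apply: le_ball xx'; lra.
  have fy : `|f x - f y| < e / 2.
    apply: dB => //; rewrite [d](splitr d); apply: ball_triangle xx' _.
    by apply: le_ball x'y; exact: ltW.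
  rewrite (_ : f x' - f y = (f x - f y) - (f x - f x')); last by ring.
  by apply: le_lt_trans (ler_normB _ _) _; lra.
exists (d / 2); first by rewrite divr_gt0.
move=> x y Ax Ay xy; apply: (H (d / 2)) => //=.
  by rewrite sub0r normrN gtr0_norm ?divr_gt0 //; lra.
by rewrite divr_gt0.
Qed.

Lemma compact_cube {R : realType} (p : nat) (M : R) : compact (@cube R p M).
Proof.
have -> : @cube R p M = trmx @` [set v : 'rV[R]_p | forall i, [set` `[- M, M]] (v ord0 i)].
  apply/seteqP; split=> [x xM|_ [v vM <-] i].
    exists x^T; last exact: trmxK.
    by move=> i /=; rewrite mxE in_itv /= -ler_norml.
  by have := vM i; rewrite /= mxE in_itv /= -ler_norml.
apply: continuous_compact; last first.
  by apply: (@rV_compact R p (fun=> [set` `[- M, M]])) => i; exact: segment_compact.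
apply: continuous_subspaceT => v s [P Pn sP].
exists (fun i j => P j i) => [i j|w wP]; first by have := Pn j i; rewrite mxE.
by apply: sP => i j; rewrite mxE.
Qed.

Lemma compact_continuous_bounded {R : realType} {T : topologicalType} (A : set T)
    (f : T -> R) : compact A -> {within A, continuous f} ->
  exists2 B : R, 0 < B & forall x, A x -> `|f x| <= B.
Proof.
move=> cA fc; have /compact_bounded [B [_ HB]] := continuous_compact fc cA.
exists (Num.max 1 (B + 1)); first by rewrite lt_max ltr01.
by move=> x Ax; apply: HB; [rewrite lt_max ltrDl ltr01 orbT | exists x].
Qed.

Lemma within_continuous_pullback {R : realType} {p n : nat} (A : set 'cV[R]_p)
    (Y : set 'cV[R]_n) (f : 'cV[R]_p -> 'cV[R]_n) (g : 'cV[R]_n -> 'cV[R]_n -> R) :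
  {within A, continuous f} -> (forall x, A x -> Y (f x)) ->
  {within Y `*` Y, continuous (fun z : 'cV[R]_n * 'cV[R]_n => g z.1 z.2)} ->
  {within A `*` A, continuous (fun z : 'cV[R]_p * 'cV[R]_p => g (f z.1) (f z.2))}.
Proof.
move=> /subspace_continuousP fc fY /subspace_continuousP gc.
apply/subspace_continuousP => -[x x'] /= [Ax Ax'] s.
move=> /(gc (f x, f x') (conj (fY _ Ax) (fY _ Ax'))).
rewrite /= /nbhs /= => -[[U V] /= [nU nV] UV].
have {}nU := fc x Ax U nU; have {}nV := fc x' Ax' V nV.
exists ((fun y => A y -> U (f y)), (fun y => A y -> V (f y))) => //.
move=> [y y'] /= [yU yV] [Ay Ay'].
by apply: (UV (f y, f y')); split => //=; [exact: yU|exact: yV|exact: fY|exact: fY].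
Qed.

Lemma cube_uniform_continuity {R : realType} {p : nat} (M : R)
    (k : 'cV[R]_p -> 'cV[R]_p -> R) :
  {within @cube R p M `*` @cube R p M,
    continuous (fun z : 'cV[R]_p * 'cV[R]_p => k z.1 z.2)} ->
  forall e, 0 < e -> exists2 d : R, 0 < d &
    forall x x' y y', @cube R p M x -> @cube R p M x' -> @cube R p M y -> @cube R p M y' ->
      (forall i, `|x i ord0 - y i ord0| < d) ->
      (forall i, `|x' i ord0 - y' i ord0| < d) ->
      `|k x x' - k y y'| < e.
Proof.
move=> kc e e0; have cA := compact_setX (compact_cube p M) (compact_cube p M).
have [d d0 H] := compact_uniform_continuity _ _ cA kc _ e0.
exists d => // x x' y y' cx cx' cy cy' xy xy'.
apply: (H (x, x') (y, y')) => //=.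
by split; (split; [exact: d0|move=> i j; rewrite (ord1 j)]); [exact: xy|exact: xy'].
Qed.

(** * Bernstein approximation of kernels *)

Definition bern {R : realType} (n k : nat) (u : R) : R :=
  'C(n, k)%:R * (u ^+ k * (1 - u) ^+ (n - k)).

(** The expectation of [F] at a binomial variable with parameters [n] and [u]. *)
Definition bern_mean {R : realType} (n : nat) (F : nat -> R) (u : R) : R :=
  \sum_(k < n.+1) F k * bern n k u.

Lemma bern_ge0 {R : realType} (n k : nat) (u : R) : 0 <= u <= 1 -> 0 <= bern n k u.
Proof.
by move=> /andP[u0 u1]; rewrite /bern !mulr_ge0 ?exprn_ge0 // subr_ge0.
Qed.

(* The first of n+1 Bernoulli(u) trials succeeds or fails. *)
Lemma bern_meanS {R : realType} (n : nat) (F : nat -> R) (u : R) :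
  bern_mean n.+1 F u =
  u * bern_mean n (fun k => F k.+1) u + (1 - u) * bern_mean n F u.
Proof.
rewrite /bern_mean /bern big_ord_recl /=.
rewrite [in X in _ = _ + _ * X]big_ord_recl /= !bin0 !expr0 !subn0 mulrDr addrCA.
congr (_ + _); first by rewrite exprS; ring.
rewrite [in X in _ = _ + X]mulr_sumr.
have -> : \sum_(i < n) (1 - u) * (F (bump 0 i) * ('C(n, bump 0 i)%:R *
     (u ^+ bump 0 i * (1 - u) ^+ (n - bump 0 i)))) =
   \sum_(i < n.+1) F i.+1 * ('C(n, i.+1)%:R * (u ^+ i.+1 * (1 - u) ^+ (n - i))).
  rewrite big_ord_recr /= bin_small // mul0r mulr0 addr0.
  apply: eq_bigr => i _; rewrite /bump leq0n add1n.
  rewrite -[in RHS](subnSK (ltn_ord i)); move: (n - i.+1)%N (u ^+ i.+1) => m v.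
  by rewrite exprS; ring.
rewrite mulr_sumr -big_split /=; apply: eq_bigr => i _.
by rewrite /bump leq0n add1n binS natrD subSS exprS; ring.
Qed.

Lemma bern_mean1 {R : realType} (n : nat) (u : R) : bern_mean n (fun=> 1) u = 1.
Proof.
elim: n => [|n IH]; last by rewrite bern_meanS IH; ring.
by rewrite /bern_mean /bern big_ord_recl big_ord0 /= bin0; ring.
Qed.

Lemma bern_meanD {R : realType} (n : nat) (F G : nat -> R) (u : R) :
  bern_mean n (fun k => F k + G k) u = bern_mean n F u + bern_mean n G u.
Proof. by rewrite -big_split /=; apply: eq_bigr => k _; rewrite mulrDl. Qed.

Lemma bern_meanZ {R : realType} (n : nat) (a : R) (F : nat -> R) (u : R) :
  bern_mean n (fun k => a * F k) u = a * bern_mean n F u.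
Proof. by rewrite /bern_mean mulr_sumr; apply: eq_bigr => k _; rewrite mulrA. Qed.

(** Conditioning on the first trial shifts the centred count by [1 - u] or [- u]; the cross terms
    vanish by the first moment. *)
Lemma bern_moments {R : realType} (n : nat) (u : R) :
  bern_mean n (fun k => k%:R - n%:R * u) u = 0 /\
  bern_mean n (fun k => (k%:R - n%:R * u) ^+ 2) u = n%:R * (u * (1 - u)).
Proof.
elim: n => [|n [IH1 IH2]].
  by rewrite /bern_mean !big_ord_recl !big_ord0 /=; split; ring.
have shift1 a : bern_mean n (fun k => (k%:R - n%:R * u) + a * 1) u = a.
  by rewrite bern_meanD bern_meanZ bern_mean1 IH1; ring.
have shift2 a : bern_mean n (fun k => (k%:R - n%:R * u) ^+ 2 +
     (2 * a * (k%:R - n%:R * u) + a ^+ 2 * 1)) u = n%:R * (u * (1 - u)) + a ^+ 2.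
  by rewrite !bern_meanD !bern_meanZ bern_mean1 IH1 IH2; ring.
rewrite !bern_meanS; split.
  transitivity (u * (1 - u) + (1 - u) * (- u)); last by ring.
  by congr (_ * _ + _ * _); rewrite -[RHS]shift1; apply: eq_bigr => k _;
    rewrite -!natr1; ring.
transitivity (u * (n%:R * (u * (1 - u)) + (1 - u) ^+ 2) +
   (1 - u) * (n%:R * (u * (1 - u)) + (- u) ^+ 2)); last by rewrite -natr1; ring.
by congr (_ * _ + _ * _); rewrite -[RHS]shift2; apply: eq_bigr => k _;
  rewrite -!natr1; ring.
Qed.

Lemma bern_variance {R : realType} (n : nat) (u : R) :
  bern_mean n.+1 (fun k => (k%:R / n.+1%:R - u) ^+ 2) u = u * (1 - u) / n.+1%:R.
Proof.
have n0 : n.+1%:R != 0 :> R by rewrite pnatr_eq0.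
transitivity (bern_mean n.+1
    (fun k => n.+1%:R ^- 2 * (k%:R - n.+1%:R * u) ^+ 2) u).
  by apply: eq_bigr => k _; congr (_ * _); field.
by rewrite bern_meanZ (bern_moments n.+1 u).2; field.
Qed.

Definition bern_weight {R : realType} {p : nat} (n : nat)
    (k : {ffun 'I_p -> 'I_n.+1}) (u : 'I_p -> R) : R :=
  \prod_i bern n (k i) (u i).

Lemma bern_weight_sum {R : realType} {p : nat} (n : nat) (u : 'I_p -> R) :
  \sum_k bern_weight n k u = 1.
Proof.
rewrite -(bigA_distr_bigA (fun i (j : 'I_n.+1) => bern n j (u i))) /=.
rewrite big1 // => i _; rewrite -[RHS](bern_mean1 n (u i)).
by apply: eq_bigr => j _; rewrite mul1r.
Qed.

(** The weight is a product law of independent binomials, so the coordinates other than [i] sum out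
    to 1. *)
Lemma bern_weight_coord {R : realType} {p : nat} (n : nat) (F : nat -> R)
    (u : 'I_p -> R) (i : 'I_p) :
  \sum_k bern_weight n k u * F (k i) = bern_mean n F (u i).
Proof.
transitivity (\sum_(k : {ffun 'I_p -> 'I_n.+1})
    \prod_j ((if j == i then F (k j) else 1) * bern n (k j) (u j))).
  apply: eq_bigr => k _; rewrite big_split /= mulrC; congr (_ * _).
  by rewrite (bigD1 i) //= eqxx big1 ?mulr1 // => j /negbTE ->.
rewrite -(bigA_distr_bigA (fun j (l : 'I_n.+1) =>
   (if j == i then F l else 1) * bern n l (u j))) /=.
rewrite (bigD1 i) //= eqxx [X in _ * X]big1 ?mulr1 // => j /negbTE ->.
by rewrite -[RHS](bern_mean1 n (u j)).
Qed.

(* Affine reparametrisation of [exp t], which maps [-M, M] onto [0, 1]. *)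
Definition exp_coord {R : realType} (M t : R) : R :=
  (expR t - expR (- M)) / (expR M - expR (- M)).

Definition exp_coord_inv {R : realType} (M s : R) : R :=
  ln (expR (- M) + (expR M - expR (- M)) * s).

Lemma exp_width_gt0 {R : realType} (M : R) : 0 < M -> 0 < expR M - expR (- M).
Proof. by move=> M0; rewrite subr_gt0 ltr_expR; lra. Qed.

Lemma exp_coord_itv {R : realType} (M t : R) : 0 < M -> `|t| <= M ->
  0 <= exp_coord M t <= 1.
Proof.
move=> M0; rewrite ler_norml => /andP[t1 t2]; have w0 := exp_width_gt0 M M0.
rewrite /exp_coord divr_ge0 ?(ltW w0) ?subr_ge0 ?ler_expR //=.
by rewrite ler_pdivrMr // mul1r lerD2r ler_expR.
Qed.

Lemma exp_coord_invK {R : realType} (M s : R) : 0 < M -> 0 <= s <= 1 ->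
  `|exp_coord_inv M s| <= M /\ exp_coord M (exp_coord_inv M s) = s.
Proof.
move=> M0 /andP[s0 s1]; have w0 := exp_width_gt0 M M0.
have e0 := expR_gt0 (- M).
set y := expR (- M) + (expR M - expR (- M)) * s.
have y1 : expR (- M) <= y by rewrite lerDl mulr_ge0 // ltW.
have y2 : y <= expR M by rewrite /y; nra.
have y0 : 0 < y by apply: lt_le_trans y1.
have yK : expR (exp_coord_inv M s) = y by rewrite lnK // posrE.
split; last by rewrite /exp_coord yK /y; field; rewrite gt_eqF.
by rewrite ler_norml -ler_expR -[X in _ && X]ler_expR yK y1.
Qed.

(** For [t <= s], factor out [expR t >= expR (- M)] and use [expR v >= 1 + v] at [v = s - t]. *)
Lemma expR_sub_lower {R : realType} (M s t : R) : `|s| <= M -> `|t| <= M ->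
  expR (- M) * `|s - t| <= `|expR s - expR t|.
Proof.
wlog st : s t / t <= s => [H sM tM|].
  case: (leP t s) => ts; first exact: H.
  by rewrite distrC [`|expR s - _|]distrC; apply: H => //; exact: ltW.
rewrite !ler_norml => _ /andP[tM _].
rewrite !ger0_norm ?subr_ge0 ?ler_expR //.
have -> : expR s - expR t = expR t * (expR (s - t) - 1).
  by rewrite mulrBr -expRD mulr1; congr (expR _ - _); ring.
apply: ler_pM; rewrite ?expR_ge0 ?subr_ge0 ?ler_expR //.
by rewrite lerBrDl expR_ge1Dx.
Qed.

Lemma exp_coord_lower {R : realType} (M s t : R) : 0 < M -> `|s| <= M -> `|t| <= M ->
  (s - t) ^+ 2 <=
  ((expR M - expR (- M)) / expR (- M) * (exp_coord M s - exp_coord M t)) ^+ 2.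
Proof.
move=> M0 sM tM; have w0 := exp_width_gt0 M M0; have e0 := expR_gt0 (- M).
have -> : (expR M - expR (- M)) / expR (- M) * (exp_coord M s - exp_coord M t) =
   (expR s - expR t) / expR (- M).
  by rewrite /exp_coord; field; rewrite !gt_eqF.
rewrite -(real_normK (num_real (s - t))) -[leRHS](real_normK (num_real _)).
rewrite lerXn2r ?nnegrE ?normr_ge0 //.
rewrite normrM [`|_^-1|]gtr0_norm ?invr_gt0 // ler_pdivlMr // mulrC.
exact: expR_sub_lower.
Qed.

Definition exp_bern {R : realType} {p : nat} (M : R) (n : nat)
    (k : {ffun 'I_p -> 'I_n.+1}) (x : 'cV[R]_p) : R :=
  bern_weight n k (fun i => exp_coord M (x i ord0)).

Lemma exp_bern_ge0 {R : realType} {p : nat} (M : R) (n : nat)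
    (k : {ffun 'I_p -> 'I_n.+1}) (x : 'cV[R]_p) : 0 < M -> @cube R p M x ->
  0 <= exp_bern M n k x.
Proof.
by move=> M0 xM; apply: prodr_ge0 => i _; apply: bern_ge0; exact: exp_coord_itv.
Qed.

Lemma exp_bern_sum {R : realType} {p : nat} (M : R) (n : nat) (x : 'cV[R]_p) :
  \sum_k exp_bern M n k x = 1.
Proof. exact: bern_weight_sum. Qed.

(** The nodes are preimages of a uniform grid in [[0, 1]]. The binomial variance there is at most
    the inverse of the degree, and [exp_coord_lower] carries it back to [x] at the cost of
    [c ^+ 2]. *)
Lemma exp_bern_concentration {R : realType} (p : nat) (M e : R) : 0 < M -> 0 < e ->
  exists (n : nat) (pt : {ffun 'I_p -> 'I_n.+1} -> 'cV[R]_p),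
    (forall k, @cube R p M (pt k)) /\
    forall x, @cube R p M x -> forall i,
      \sum_k exp_bern M n k x * (x i ord0 - pt k i ord0) ^+ 2 <= e.
Proof.
move=> M0 e0; set c := (expR M - expR (- M)) / expR (- M).
have [n nle] := archi_div_lt (c ^+ 2) e e0.
pose s (k : 'I_n.+2) : R := k%:R / n.+1%:R.
have s01 k : 0 <= s k <= 1.
  by rewrite divr_ge0 //= ler_pdivrMr ?ltr0Sn // mul1r ler_nat -ltnS.
exists n.+1, (fun k => \col_i exp_coord_inv M (s (k i))); split.
  by move=> k i; rewrite mxE; have [] := exp_coord_invK M _ M0 (s01 (k i)).
move=> x xM i; set u := exp_coord M (x i ord0).
have /andP[u0 u1] : 0 <= u <= 1 by exact: exp_coord_itv.
apply: le_trans (_ : c ^+ 2 * (u * (1 - u) / n.+1%:R) <= _).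
  rewrite -bern_variance -bern_meanZ.
  rewrite -(bern_weight_coord n.+1 _ (fun i => exp_coord M (x i ord0))).
  apply: ler_sum => k _; apply: ler_wpM2l; first exact: exp_bern_ge0.
  rewrite mxE; have [pM pK] := exp_coord_invK M _ M0 (s01 (k i)).
  apply: le_trans (exp_coord_lower M _ _ M0 (xM i) pM) _.
  by rewrite pK exprMn -[X in _ * X <= _]sqrrN opprB.
apply: le_trans (ltW nle); rewrite mulrA ler_pM2r ?invr_gt0 ?ltr0Sn //.
by rewrite ler_piMr ?sqr_ge0 //; nra.
Qed.

Lemma exp_bern_kernel_approx {R : realType} {p : nat} (M : R)
    (k : 'cV[R]_p -> 'cV[R]_p -> R) (e : R) : 0 < M -> 0 < e ->
  {within @cube R p M `*` @cube R p M,
    continuous (fun z : 'cV[R]_p * 'cV[R]_p => k z.1 z.2)} ->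
  exists (n : nat) (pt : {ffun 'I_p -> 'I_n.+1} -> 'cV[R]_p),
    (forall a, @cube R p M (pt a)) /\
    forall x x', @cube R p M x -> @cube R p M x' ->
      `|k x x' - \sum_a \sum_b exp_bern M n a x * exp_bern M n b x' *
          k (pt a) (pt b)| < e.
Proof.
move=> M0 e0 kc.
have cA := compact_setX (compact_cube p M) (compact_cube p M).
have [B B0 kB] := compact_continuous_bounded _ _ cA kc.
have e20 : 0 < e / 2 by rewrite divr_gt0.
have [d d0 kd] := cube_uniform_continuity _ _ kc _ e20.
have p1 : 0 < p%:R + 1 :> R by rewrite ltr_wpDl.
(* Chosen so that [c * (p%:R * h) < e / 4] for the [c] below, once for each argument; [p%:R + 1]
   keeps the denominator positive when [p = 0]. *)
pose h := e * d ^+ 2 / (16 * B * (p%:R + 1)).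
have h0 : 0 < h by rewrite divr_gt0 // ?mulr_gt0 // exprn_gt0.
have [n [pt [ptM var]]] := exp_bern_concentration p M h M0 h0.
exists n, pt; split=> // x x' xM x'M.
pose D (x : 'cV[R]_p) a := \sum_i (x i ord0 - pt a i ord0) ^+ 2.
have D0 y a : 0 <= D y a by apply: sumr_ge0 => i _; exact: sqr_ge0.
have Dfar (y : 'cV[R]_p) a i : ~~ (`|y i ord0 - pt a i ord0| < d) -> d ^+ 2 <= D y a.
  rewrite -leNgt => far; apply: le_trans (_ : (y i ord0 - pt a i ord0) ^+ 2 <= _).
    by rewrite -[leRHS]real_normK ?num_real // lerXn2r ?nnegrE ?(ltW d0).
  rewrite /D (bigD1 i) //= lerDl; apply: sumr_ge0 => j _; exact: sqr_ge0.
pose c := 2 * B / d ^+ 2.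
have c0 : 0 <= c by rewrite divr_ge0 ?mulr_ge0 ?exprn_ge0 ?ltW.
(* Chebyshev's argument: if all coordinates are within [d], uniform continuity gives [e / 2];
   otherwise one of the [D] is at least [d ^+ 2], and [c] times it exceeds the trivial bound
   [2 * B]. *)
have dev a b : `|k x x' - k (pt a) (pt b)| <= e / 2 + c * (D x a + D x' b).
  have far : d ^+ 2 <= D x a + D x' b ->
      `|k x x' - k (pt a) (pt b)| <= e / 2 + c * (D x a + D x' b).
    move=> dD; apply: le_trans (_ : 2 * B <= _).
      apply: le_trans (ler_normB _ _) _.
      have := kB (x, x') (conj xM x'M); have := kB (pt a, pt b) (conj (ptM a) (ptM b)).
      by move=> /=; lra.
    apply: le_trans (_ : c * d ^+ 2 <= _); first by rewrite divfK // gt_eqF ?exprn_gt0.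
    have := ler_wpM2l c0 dD; lra.
  have [/forallP xa|/forallPn [i /Dfar]] :=
      boolP [forall i, `|x i ord0 - pt a i ord0| < d]; last first.
    by move=> dD; apply: far; apply: le_trans dD _; rewrite lerDl.
  have [/forallP xb|/forallPn [i /Dfar]] :=
      boolP [forall i, `|x' i ord0 - pt b i ord0| < d]; last first.
    by move=> dD; apply: far; apply: le_trans dD _; rewrite lerDr.
  apply: le_trans (ltW (kd _ _ _ _ xM x'M (ptM a) (ptM b) xa xb)) _.
  by rewrite lerDl mulr_ge0 // addr_ge0.
have Dmean y : @cube R p M y -> \sum_a exp_bern M n a y * D y a <= p%:R * h.
  move=> yM; under eq_bigr do rewrite mulr_sumr.
  rewrite exchange_big /= mulr_natl -[X in _ *+ X]card_ord -sumr_const.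
  by apply: ler_sum => i _; exact: var.
pose W a := exp_bern M n a x; pose W' b := exp_bern M n b x'.
have W0 a : 0 <= W a by exact: exp_bern_ge0.
have W'0 a : 0 <= W' a by exact: exp_bern_ge0.
have mean (F G : {ffun 'I_p -> 'I_n.+1} -> R) : \sum_a \sum_b W a * W' b * (F a * G b) =
    (\sum_a W a * F a) * (\sum_b W' b * G b).
  rewrite mulr_suml; apply: eq_bigr => a _; rewrite mulr_sumr.
  by apply: eq_bigr => b _; rewrite mulrACA.
have WS (q : R) : \sum_a W a * q = q by rewrite -mulr_suml exp_bern_sum mul1r.
have W'S (q : R) : \sum_b W' b * q = q by rewrite -mulr_suml exp_bern_sum mul1r.
have -> : k x x' - \sum_a \sum_b W a * W' b * k (pt a) (pt b) =
    \sum_a \sum_b W a * W' b * (k x x' - k (pt a) (pt b)).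
  have := mean (fun=> k x x') (fun=> 1); rewrite WS W'S mulr1 => {1}<-.
  rewrite -sumrB; apply: eq_bigr => a _; rewrite -sumrB.
  by apply: eq_bigr => b _; rewrite mulrBr.
apply: le_lt_trans (ler_norm_sum _ _ _) _.
(* The factors 1 put each summand in the product form that [mean] factorises. *)
apply: le_lt_trans (_ : \sum_a \sum_b W a * W' b *
   (e / 2 * 1 + (c * D x a) * 1 + c * D x' b) < e).
  apply: ler_sum => a _; apply: le_trans (ler_norm_sum _ _ _) _.
  apply: ler_sum => b _; rewrite normrM ger0_norm ?mulr_ge0 //.
  by rewrite ler_wpM2l ?mulr_ge0 // (le_trans (dev a b)) // mulrDr !mulr1 addrA.
have -> : \sum_a \sum_b W a * W' b * (e / 2 * 1 + (c * D x a) * 1 + c * D x' b) =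
    e / 2 + c * (\sum_a W a * D x a) + c * (\sum_b W' b * D x' b).
  transitivity (\sum_a \sum_b W a * W' b * (e / 2 * 1) +
     \sum_a \sum_b W a * W' b * ((c * D x a) * 1) +
     \sum_a \sum_b W a * W' b * (c * D x' b)).
    rewrite -!big_split /=; apply: eq_bigr => a _; rewrite -!big_split /=.
    by apply: eq_bigr => b _; rewrite !mulrDr.
  rewrite (mean (fun=> e / 2) (fun=> 1)) (mean (fun a => c * D x a) (fun=> 1)).
  rewrite (mean (fun=> c) (D x')) !WS !W'S !mulr1; congr (_ + _ + _).
  by rewrite mulr_sumr; apply: eq_bigr => a _; rewrite mulrCA.
have := ler_wpM2l c0 (Dmean x xM); have := ler_wpM2l c0 (Dmean x' x'M).
have ch : c * (p%:R * h) < e / 4.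
  have -> : c * (p%:R * h) = e / 8 * (p%:R / (p%:R + 1)).
    by rewrite /c /h; field; rewrite !gt_eqF.
  have : p%:R / (p%:R + 1) <= 1 :> R by rewrite ler_pdivrMr // mul1r lerDl.
  nra.
rewrite -/W -/W'; lra.
Qed.

(** * Bernstein weights as limits of networks *)

(* The functions [m] with [mult_approx m] form an algebra, which is what makes
   products of exponentials of different coordinates accessible to networks. *)
Definition exp_absorbing {R : realType} {p : nat} (sigma : R -> R) (M : R)
    (f : 'cV[R]_p -> R) : Prop :=
  forall b, net_approx sigma M (fun x => f x * expR (inner b x)).

(** Quantifying over all absorbing [f] makes multipliers compose, so closure under products is
    immediate. *)
Definition mult_approx {R : realType} {p : nat} (sigma : R -> R) (M : R)
    (m : 'cV[R]_p -> R) : Prop :=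
  forall f, exp_absorbing sigma M f -> exp_absorbing sigma M (fun x => f x * m x).

Section MultApprox.
Context {R : realType} {p : nat} (sigma : R -> R) (M : R).
Implicit Types m : 'cV[R]_p -> R.

Lemma eq_mult_approx m m' : (forall x, m x = m' x) ->
  mult_approx sigma M m -> mult_approx sigma M m'.
Proof.
by move=> mm' mA f fA b; apply: eq_net_approx (mA f fA b) => x; rewrite mm'.
Qed.

Lemma mult_approx_cst (a : R) : @mult_approx R p sigma M (fun=> a).
Proof.
by move=> f fA b; apply: eq_net_approx (net_approxZ _ _ a _ (fA b)) => x; ring.
Qed.

Lemma mult_approxD m m' : mult_approx sigma M m -> mult_approx sigma M m' ->
  mult_approx sigma M (fun x => m x + m' x).
Proof.
move=> mA mA' f fA b.
by apply: eq_net_approx (net_approxD _ _ _ _ (mA f fA b) (mA' f fA b)) => x; ring.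
Qed.

Lemma mult_approxM m m' : mult_approx sigma M m -> mult_approx sigma M m' ->
  mult_approx sigma M (fun x => m x * m' x).
Proof.
move=> mA mA' f fA b.
by apply: eq_net_approx (mA' _ (mA f fA) b) => x; rewrite mulrA.
Qed.

Lemma mult_approxX m n : mult_approx sigma M m ->
  mult_approx sigma M (fun x => m x ^+ n).
Proof.
move=> mA; elim: n => [|n IH].
  by apply: eq_mult_approx (mult_approx_cst 1) => x; rewrite expr0.
by apply: eq_mult_approx (mult_approxM _ _ mA IH) => x; rewrite exprS.
Qed.

Lemma mult_approx_prod (I : Type) (r : seq I) (F : I -> 'cV[R]_p -> R) :
  (forall i, mult_approx sigma M (F i)) ->
  mult_approx sigma M (fun x => \prod_(i <- r) F i x).
Proof.
move=> FA; elim: r => [|i r IH].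
  by apply: eq_mult_approx (mult_approx_cst 1) => x; rewrite big_nil.
by apply: eq_mult_approx (mult_approxM _ _ (FA i) IH) => x; rewrite big_cons.
Qed.

(** Multiplying by [expR (x i ord0)] only adds a basis vector to the exponent [b]. *)
Lemma mult_approx_expR (i : 'I_p) : mult_approx sigma M (fun x => expR (x i ord0)).
Proof.
move=> f fA b; apply: eq_net_approx (fA (delta_mx i ord0 + b)) => x.
rewrite innerDl expRD mulrA; congr (_ * expR _ * _).
rewrite /inner (bigD1 i) //= mxE !eqxx mul1r big1 ?addr0 // => j /negbTE ji.
by rewrite mxE ji mul0r.
Qed.

Lemma net_approx_exp_bern (n : nat) (k : {ffun 'I_p -> 'I_n.+1}) :
  admissible_activation sigma -> net_approx sigma M (exp_bern M n k).
Proof.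
move=> sadm.
have oneA : @exp_absorbing R p sigma M (fun=> 1).
  move=> b; apply: (eq_net_approx _ _ (fun x => expR (inner b x))) => [x|].
    by rewrite mul1r.
  exact: net_approx_expR.
(* The weight is a polynomial in the [expR (x i ord0)], hence a multiplier; apply it to the constant
   1 with [b = 0]. *)
suff mA : mult_approx sigma M (exp_bern M n k).
  apply: eq_net_approx (mA _ oneA 0) => x.
  by rewrite inner0l expR0 mul1r mulr1.
apply: mult_approx_prod => i.
have uA : mult_approx sigma M (fun x => exp_coord M (x i ord0)).
  apply: mult_approxM; last exact: mult_approx_cst.
  by apply: mult_approxD; [exact: mult_approx_expR | exact: mult_approx_cst].
apply: mult_approxM; first exact: mult_approx_cst.
apply: mult_approxM; apply: mult_approxX => //.
apply: (eq_mult_approx (fun x => 1 + (-1) * exp_coord M (x i ord0))) => [x|].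
  by rewrite mulN1r.
apply: mult_approxD; first exact: mult_approx_cst.
by apply: mult_approxM => //; exact: mult_approx_cst.
Qed.

End MultApprox.

(** * Vector-valued networks and the final estimate *)

Lemma networks_of_nets {R : realType} {p : nat} (sigma : R -> R) (K : nat)
    (s : 'I_K -> seq (R * 'cV[R]_p * R)) :
  exists (T : nat) (A : 'M[R]_(K, T)) (B : 'M[R]_(T, p)) (c : 'cV[R]_T),
    forall x l, network sigma A B c x l ord0 = net sigma (s l) x.
Proof.
(* All hidden layers are stacked into one; a neuron serving output [l] gets an outer weight vector
   supported on [l]. *)
pose v : seq ('cV[R]_K * 'cV[R]_p * R) :=
  flatten [seq [seq (q.1.1 *: delta_mx l ord0, q.1.2, q.2) | q <- s l] | l <- enum 'I_K].
pose v_ t := nth (0, 0, 0) v t.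
exists (size v), (\matrix_(l, t) (v_ t).1.1 l ord0), (\matrix_(t, j) (v_ t).1.2 j ord0),
  (\col_t (v_ t).2) => x l.
transitivity (\sum_(q <- v) q.1.1 l ord0 * sigma (inner q.1.2 x + q.2)).
  rewrite (big_nth (0, 0, 0)) big_mkord mxE; apply: eq_bigr => t _.
  rewrite !mxE; congr (_ * sigma (_ + _)).
  by apply: eq_bigr => j _; rewrite mxE.
rewrite big_flatten big_map big_enum /= (bigD1 l) //= [X in _ + X]big1 => [|j jl].
  rewrite addr0 big_map; apply: eq_bigr => q _ /=.
  by rewrite !mxE !eqxx mulr1.
rewrite big_map big1 // => q _ /=.
by rewrite !mxE eq_sym (negbTE jl) mulr0 mul0r.
Qed.

Lemma network_approx {R : realType} {p : nat} (sigma : R -> R) (M : R) (K : nat)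
    (F : 'I_K -> 'cV[R]_p -> R) (e : R) : 0 < e ->
  (forall l, net_approx sigma M (F l)) ->
  exists (T : nat) (A : 'M[R]_(K, T)) (B : 'M[R]_(T, p)) (c : 'cV[R]_T),
    forall x, @cube R p M x -> forall l, `|F l x - network sigma A B c x l ord0| < e.
Proof.
move=> e0 FA; have /choice [s sP] l := FA l e e0.
have [T [A [B [c H]]]] := networks_of_nets sigma K s.
by exists T, A, B, c => x xM l; rewrite H; exact: sP.
Qed.

(** Each coordinate contributes at most [H * d + (H + d) * d], and [d <= 1] makes this at most
    [(2 * H + 1) * d]. *)
Lemma inner_close {R : realType} (K : nat) (u u' v v' : 'cV[R]_K) (H d : R) : 0 <= H ->
  0 <= d <= 1 -> (forall l, `|u l ord0| <= H) -> (forall l, `|u' l ord0| <= H) ->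
  (forall l, `|u l ord0 - v l ord0| <= d) -> (forall l, `|u' l ord0 - v' l ord0| <= d) ->
  `|inner u u' - inner v v'| <= K%:R * ((2 * H + 1) * d).
Proof.
move=> H0 /andP[d0 d1] uH u'H uv u'v'.
rewrite /inner -sumrB; apply: le_trans (ler_norm_sum _ _ _) _.
rewrite mulr_natl -[X in _ *+ X]card_ord -sumr_const; apply: ler_sum => l _.
have -> : u l ord0 * u' l ord0 - v l ord0 * v' l ord0 =
    u l ord0 * (u' l ord0 - v' l ord0) + v' l ord0 * (u l ord0 - v l ord0) by ring.
apply: le_trans (ler_normD _ _) _; rewrite !normrM.
have v'H : `|v' l ord0| <= H + d.
  rewrite (_ : v' l ord0 = u' l ord0 - (u' l ord0 - v' l ord0)); last by ring.
  by apply: le_trans (ler_normB _ _) _; apply: lerD.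
have := ler_pM (normr_ge0 _) (normr_ge0 _) (uH l) (u'v' l).
have := ler_pM (normr_ge0 _) (normr_ge0 _) v'H (uv l).
nra.
Qed.

Theorem theorem4p2 (R : realType) (Kstar : nat) (M : R) (p : nat)
  (Y : set 'cV[R]_Kstar) (fstar : 'cV[R]_p -> 'cV[R]_Kstar)
  (gstar : 'cV[R]_Kstar -> 'cV[R]_Kstar -> R) (sigma : R -> R) :
  0 < M ->
  compact Y ->
  {within @cube R p M, continuous fstar} ->
  (forall x, @cube R p M x -> Y (fstar x)) ->
  CPD Y gstar ->
  admissible_activation sigma ->
  forall eps : R, 0 < eps ->
  exists C : R, exists r0 : R, 0 < C /\ 0 < r0 /\
  forall r : R, r0 <= r ->
  exists (K T : nat) (A : 'M[R]_(K, T)) (B : 'M[R]_(T, p)) (c : 'cV[R]_T)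
         (gamma : R),
    `|gamma| <= C * r ^+ 2 /\
    forall x x' : 'cV[R]_p, @cube R p M x -> @cube R p M x' ->
      `|gstar (fstar x) (fstar x')
        - (inner (network sigma A B c x) (network sigma A B c x') - gamma)|
      < eps + C * r ^- 2.
Proof.
move=> M0 _ fc fY [[gsym gc] gcpd] sadm e e0.
pose k x x' := gstar (fstar x) (fstar x').
have kc := within_continuous_pullback _ _ _ _ fc fY gc.
have cA := compact_setX (compact_cube p M) (compact_cube p M).
have [Bd Bd0 kB] := compact_continuous_bounded _ _ cA kc.
have e20 : 0 < e / 2 by rewrite divr_gt0.
have [n [pt [ptM bern]]] := exp_bern_kernel_approx M k _ M0 e20 kc.
pose G a b := k (pt a) (pt b).
pose s : {ffun 'I_p -> 'I_n.+1} := [ffun=> ord0].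
pose h a := G a s - G s s / 2.
have hB a : `|h a| <= 2 * Bd.
  apply: le_trans (ler_normB _ _) _; rewrite normrM [`|2^-1|]ger0_norm ?invr_ge0 //.
  have := kB (pt a, pt s) (conj (ptM a) (ptM s)).
  have := kB (pt s, pt s) (conj (ptM s) (ptM s)).
  by rewrite /= -/(k _ _) -/(k _ _) -!/(G _ _); lra.
have Gsym a b : G a b = G b a by apply: gsym; apply: fY.
have Gcpd c : \sum_a c a = 0 -> 0 <= quad_form G c.
  (* Conditional positivity speaks of families indexed by ordinals, so the nodes are enumerated by
     [enum_val]. *)
  move=> c0; have := gcpd _ (fun i : 'I_#|{ffun 'I_p -> 'I_n.+1}| => fstar (pt (enum_val i)))
    (fun i => c (enum_val i)) (fun i => fY _ (ptM _)).
  have reindex (F : {ffun 'I_p -> 'I_n.+1} -> R) :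
      \sum_(i < #|{ffun 'I_p -> 'I_n.+1}|) F (enum_val i) = \sum_a F a.
    by rewrite -(big_enum_val F); apply: eq_bigl.
  rewrite reindex => /(_ c0).
  rewrite (reindex (fun a => \sum_j c a * c (enum_val j) *
     gstar (fstar (pt a)) (fstar (pt (enum_val j))))).
  by under eq_bigr do rewrite (reindex (fun b => c _ * c b * k (pt _) (pt b))).
(* The 1 covers [gamma = r ^+ 2]; [4 * Bd ^+ 2] bounds the product of two averages of [h], each at
   most [2 * Bd]. The threshold 1 makes [r] positive. *)
exists (1 + 4 * Bd ^+ 2), 1; split; first by rewrite ltr_pwDl // mulr_ge0 // sqr_ge0.
split=> // r r1; have r0 : 0 < r by apply: lt_le_trans r1.
have [|K [L GL]] := psd_gram _ (cpd_shift_psd G s r _ Gsym Gcpd); first by rewrite gt_eqF.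
pose W (a : {ffun 'I_p -> 'I_n.+1}) (x : 'cV[R]_p) := exp_bern M n a x.
pose Phi (l : 'I_K) (x : 'cV[R]_p) := \sum_a W a x * L l a.
pose H := \sum_l \sum_a `|L l a|.
have H0 : 0 <= H by apply: sumr_ge0 => l _; apply: sumr_ge0.
have PhiH x l : @cube R p M x -> `|Phi l x| <= H.
  move=> xM; apply: le_trans (ler_norm_sum _ _ _) _.
  apply: le_trans (_ : \sum_a `|L l a| <= _); last first.
    rewrite /H (bigD1 l) //= lerDl; apply: sumr_ge0 => j _; exact: sumr_ge0.
  apply: ler_sum => a _; rewrite normrM ler_piMl // ger0_norm ?exp_bern_ge0 //.
  rewrite -(exp_bern_sum M n x) (bigD1 a) //= lerDl.
  by apply: sumr_ge0 => b _; exact: exp_bern_ge0.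
pose Q := K%:R * (2 * H + 1); have Q0 : 0 <= Q by rewrite mulr_ge0 // addr_ge0 // mulr_ge0.
have Qe0 : 0 < Q + e / 2 by rewrite ltr_wpDl.
(* Ensures both [d <= 1] and [Q * d < e / 2], where [Q * d] is the bound of [inner_close]. It
   depends on [r] through [L], which is harmless as the network is chosen after [r]. *)
pose d := e / 2 / (Q + e / 2).
have d0 : 0 < d by rewrite divr_gt0.
have d1 : d <= 1 by rewrite ler_pdivrMr // mul1r lerDr.
have Qd : Q * d < e / 2 by rewrite /d mulrA ltr_pdivrMr //; nra.
have [|T [A [B [c net]]]] := network_approx sigma M K Phi d d0.
  move=> l; apply: net_approx_sum => a.
  apply: eq_net_approx (net_approxZ _ _ (L l a) _ (net_approx_exp_bern sigma M n a sadm)).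
  by move=> x; rewrite mulrC.
exists K, T, A, B, c, (r ^+ 2); split.
  rewrite ger0_norm ?sqr_ge0 // mulrDl mul1r lerDl.
  by rewrite mulr_ge0 ?sqr_ge0 // mulr_ge0 ?sqr_ge0.
move=> x x' xM x'M.
pose u := \col_l Phi l x; pose u' := \col_l Phi l x'.
have close : `|inner u u' - inner (network sigma A B c x) (network sigma A B c x')| < e / 2.
  apply: le_lt_trans Qd; rewrite /Q -mulrA; apply: inner_close => //.
  - by rewrite (ltW d0).
  - by move=> l; rewrite mxE PhiH.
  - by move=> l; rewrite mxE PhiH.
  - by move=> l; rewrite mxE; apply: ltW; exact: net.
  - by move=> l; rewrite mxE; apply: ltW; exact: net.
have mean2 (F F' : {ffun 'I_p -> 'I_n.+1} -> R) :
    \sum_a \sum_b W a x * W b x' * (F a * F' b) =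
    (\sum_a W a x * F a) * (\sum_b W b x' * F' b).
  rewrite mulr_suml; apply: eq_bigr => a _; rewrite mulr_sumr.
  by apply: eq_bigr => b _; rewrite mulrACA.
(* Since the weights sum to 1, the ideal features reproduce the Bernstein approximation of [k], plus
   exactly [gamma], plus a rank-one term of order [r ^- 2]. *)
have gram : inner u u' = \sum_a \sum_b W a x * W b x' * G a b + r ^+ 2
    + (\sum_a W a x * h a) * (\sum_b W b x' * h b) / r ^+ 2.
  transitivity (\sum_a \sum_b W a x * W b x' * \sum_l L l a * L l b).
    under [RHS]eq_bigr do under eq_bigr do rewrite mulr_sumr.
    under [RHS]eq_bigr do rewrite exchange_big /=.
    rewrite exchange_big /=; apply: eq_bigr => l _.
    by rewrite !mxE mean2.
  have mean1 (q : R) : \sum_a \sum_b W a x * W b x' * (q * 1) = q.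
    rewrite (mean2 (fun=> q) (fun=> 1)) -!mulr_suml !exp_bern_sum; ring.
  rewrite -{1}[r ^+ 2]mean1 -mean2 mulr_suml -!big_split /=.
  apply: eq_bigr => a _; rewrite mulr_suml -!big_split /=; apply: eq_bigr => b _.
  by rewrite -GL /h; ring.
have hmean y : @cube R p M y -> `|\sum_a W a y * h a| <= 2 * Bd.
  move=> yM; apply: le_trans (ler_norm_sum _ _ _) _.
  apply: le_trans (_ : \sum_a W a y * (2 * Bd) <= _); last first.
    by rewrite -mulr_suml exp_bern_sum mul1r.
  apply: ler_sum => a _; rewrite normrM ger0_norm ?exp_bern_ge0 //.
  by rewrite ler_wpM2l // exp_bern_ge0.
have rV0 : 0 <= r ^- 2 by rewrite invr_ge0 sqr_ge0.
have hh : `|(\sum_a W a x * h a) * (\sum_b W b x' * h b) / r ^+ 2| <= 4 * Bd ^+ 2 * r ^- 2.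
  rewrite normrM [`|r ^- 2|]ger0_norm // ler_wpM2r // normrM.
  have := ler_pM (normr_ge0 _) (normr_ge0 _) (hmean x xM) (hmean x' x'M).
  by move/le_trans; apply; rewrite expr2; lra.
(* The error splits into [e / 2] for Bernstein, [e / 2] for the network and the rank-one term. *)
have := bern x x' xM x'M; rewrite -/(k _ _).
move: close hh; rewrite gram !(ler_norml, ltr_norml).
move=> /andP[? ?] /andP[? ?] /andP[? ?].
by apply/andP; split; lra.
Qed.
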